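(* Let $m\geq 2$ be an integer and let $G$ be a finite group. Then $G$ admits an $m$-partite oriented semiregular representation ($m$-POSR) if and only if it is not the case that $m=2$ and $G$ is isomorphic to one of $\mathbb{Z}_3$, $\mathbb{Z}_2^2$, or $\mathbb{Z}_2^3$.
   Context: $\mathbb{Z}_n$ denotes the cyclic group of order $n$. All digraphs are finite and without loops. A digraph is oriented (an oriented graph) if there is at most one arc between any two vertices, i.e. for distinct vertices $u,v$ at most one of $(u,v)$, $(v,u)$ is an arc. $\mathrm{Aut}(\Gamma)$ is the group of permutations of the vertex set of $\Gamma$ preserving the arc set. A digraph is $m$-partite with respect to a partition of its vertex set into $m$ nonempty parts if no arc joins two vertices in the same part. A group acting on a set $\Omega$ is semiregular on $\Omega$ if the stabilizer of every point of $\Omega$ is trivial. For an integer $m\ge 2$, a group $G$ admits an $m$-partite oriented semiregular representation ($m$-POSR) if there exists an $m$-partite oriented graph $\Gamma$ (not required to be regular) such that $\mathrm{Aut}(\Gamma)$ is isomorphic to $G$ and acts semiregularly on the vertex set of $\Gamma$ with exactly $m$ orbits, these orbits being the $m$ parts of the $m$-partition. *)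

(* Defs.v *)
From mathcomp Require Import all_boot all_fingroup.

Set Implicit Arguments.
Unset Strict Implicit.
Unset Printing Implicit Defensive.

Import GroupScope.

Section Digraphs.

Variables (V : finType) (arc : rel V).

Definition oriented : Prop :=
  irreflexive arc /\ forall u v : V, u != v -> ~~ (arc u v && arc v u).

Definition digraph_aut : {set {perm V}} :=
  [set s : {perm V} | [forall u, forall v, arc (s u) (s v) == arc u v]].

Lemma digraph_autP (s : {perm V}) :
  reflect (forall u v, arc (s u) (s v) = arc u v) (s \in digraph_aut).
Proof.
rewrite inE; apply: (iffP forallP) => [h u v | h u].
  by apply/eqP; move/forallP: (h u).
by apply/forallP => v; rewrite h.
Qed.

Lemma digraph_aut_group_set : group_set digraph_aut.
Proof.
apply/group_setP; split=> [|s t /digraph_autP hs /digraph_autP ht];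
  apply/digraph_autP => u v; first by rewrite !perm1.
by rewrite !permM ht hs.
Qed.

Canonical digraph_aut_group := Group digraph_aut_group_set.

(* [partition P setT] forces the blocks of P to be nonempty. *)
Definition multipartite (m : nat) (P : {set {set V}}) : Prop :=
  [/\ partition P [set: V], #|P| = m
    & forall (B : {set V}) (u v : V), B \in P -> u \in B -> v \in B ->
        ~~ arc u v].

End Digraphs.

Definition semiregular_on (V : finType) (A : {group {perm V}}) : Prop :=
  forall v : V, 'C_A[v | 'P] = 1.

Definition orbits_on (V : finType) (A : {group {perm V}}) : {set {set V}} :=
  orbit 'P A @: [set: V].

Definition admits_POSR (m : nat) (gT : finGroupType) (G : {group gT}) : Prop :=
  exists (V : finType) (arc : rel V) (P : {set {set V}}),
    [/\ oriented arc, multipartite arc m P, digraph_aut arc \isog G,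
        semiregular_on (digraph_aut_group arc)
      & orbits_on (digraph_aut_group arc) = P].

(* Main.v *)
Require Import Defs.
From mathcomp Require Import all_boot all_fingroup all_algebra all_solvable.

Set Implicit Arguments.
Unset Strict Implicit.
Unset Printing Implicit Defensive.

Import GroupScope.

(* A bipartite oriented graph on two copies of G with G acting regularly on each
   copy is a colouring of G by three colours (arc forward, arc backward, no
   arc). The parts cannot be exchanged when two chosen classes have different
   sizes, so it suffices to find rigid colourings, i.e. those whose
   part-preserving colour automorphisms are the translations. If H < G has a
   rigid colouring with a connected class, then so has <H, x>: colour everything
   outside H except x alike, away from that class; the cosets of H are then
   blocks, and the edges labelled x tie the blocks together. The class
   containing most of the complement of H is connected, so this iterates up to G.
   Starting points are a cyclic group of order at least 4, a group generated by
   elements of orders 3 and 2, Z_3^2 and Z_2^4. The groups left over have order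
   at most 2 or are Z_3, Z_2^2 and Z_2^3. A further part is attached by a perfect
   matching directed towards it: its vertices become the sinks. The three
   exceptional groups are 3-generated and have tripartite representations. In
   the bipartite case every colouring of Z_2^2 or Z_2^3 is fixed by some
   transvection, and every colouring of Z_3 by a reflection or by an exchange of
   the two parts. *)

(** * Haar digraphs *)

Section HaarDigraph.

Variables (gT : finGroupType) (I : finType).
Implicit Types (T : I -> I -> {set gT}) (s : {perm gT * I}).

(** A Cayley digraph with one copy of the group per part: right translations leave the quotient
    [q.1 * p.1^-1] unchanged, so they act regularly on each part. *)
Definition haar_arc T : rel (gT * I) :=
  fun p q => q.1 * p.1^-1 \in T p.2 q.2.

Definition haar_rep T : Prop :=
  [/\ forall i, T i i = set0,
      forall i j d, d \in T i j -> d^-1 \notin T j i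
    & forall s, s \in digraph_aut (haar_arc T) ->
        exists g, forall p, s p = (p.1 * g, p.2)].

Definition translate (g : gT) (p : gT * I) := (p.1 * g, p.2).

Lemma translate_inj g : injective (translate g).
Proof. by case=> x i [y j] [/mulIg -> ->]. Qed.

Definition translation g : {perm gT * I} := perm (@translate_inj g).

Lemma translationE g p : translation g p = (p.1 * g, p.2).
Proof. by rewrite permE. Qed.

Lemma translationM : {in [set: gT] &, {morph translation : x y / x * y}}.
Proof.
by move=> x y _ _; apply/permP=> p; rewrite permM !translationE /= mulgA.
Qed.

Canonical translation_morphism := Morphism translationM.

Lemma translation_aut T g : translation g \in digraph_aut (haar_arc T).
Proof.
apply/digraph_autP=> p q; rewrite /haar_arc !translationE /=.
by rewrite invMg mulgA mulgK.
Qed.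

Lemma haar_rep_aut T : haar_rep T ->
  digraph_aut (haar_arc T) = translation @* [set: gT].
Proof.
case=> _ _ autT; apply/setP=> s; rewrite morphimEdom; apply/idP/imsetP.
  by case/autT=> g sE; exists g; rewrite ?inE //; apply/permP=> p;
    rewrite sE translationE.
by case=> g _ ->; apply: translation_aut.
Qed.

Lemma haar_rep_POSR T (i0 : I) : haar_rep T -> admits_POSR #|I| [set: gT].
Proof.
move=> repT; have autE := haar_rep_aut repT; case: repT => T0 Tanti _.
pose part i : {set gT * I} := [set p | p.2 == i].
have part_inj : injective part.
  by move=> i j /setP/(_ (1, i)); rewrite !inE eqxx => /esym/eqP.
have orbE p : orbit 'P (digraph_aut (haar_arc T)) p = part p.2.
  apply/setP=> q; rewrite inE autE; apply/orbitP/eqP.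
    by case=> s; rewrite morphimEdom => /imsetP[g _ ->] <-;
      rewrite /= /aperm translationE.
  move=> eq2; exists (translation (p.1^-1 * q.1)).
    by rewrite mem_morphim ?inE.
  by rewrite /= /aperm translationE mulKVg -eq2 -surjective_pairing.
exists (gT * I)%type, (haar_arc T), [set part i | i : I]; split.
- split=> [p|p q _]; first by rewrite /haar_arc T0 inE.
  apply/negP=> /andP[/Tanti]; rewrite /haar_arc.
  by rewrite invMg invgK => /negP.
- split.
  + apply/and3P; split.
    * apply/eqP/setP=> p; rewrite inE; apply/bigcupP; exists (part p.2).
        by apply/imsetP; exists p.2.
      by rewrite inE.
    * apply/trivIsetP=> _ _ /imsetP[i _ ->] /imsetP[j _ ->] neq.
      rewrite -setI_eq0; apply/eqP/setP=> p; rewrite !inE.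
      by apply/andP=> -[/eqP pi /eqP pj]; rewrite -pi -pj eqxx in neq.
    * by apply/imsetP=> -[i _] /setP/(_ (1, i)); rewrite !inE eqxx.
  + by rewrite card_imset.
  + move=> _ p q /imsetP[i _ ->]; rewrite !inE /haar_arc.
    by move=> /eqP-> /eqP->; rewrite T0 inE.
- rewrite autE isog_sym; apply: (sub_isog (subxx _)).
  apply/injmP=> x y _ _ /permP/(_ (1, _)) eqxy.
  by have := eqxy i0; rewrite !translationE /= !mul1g => -[].
- move=> p; apply/trivgP/subsetP=> s; rewrite inE /= autE morphimEdom.
  case/andP=> /imsetP[g _ ->] /astab1P; rewrite /= /aperm translationE.
  case: p => x i [] /(canRL (mulKg x)); rewrite mulVg => ->.
  by rewrite (morph1 translation_morphism) set11.
- apply/setP=> B; apply/imsetP/imsetP=> [[p _ ->]|[i _ ->]].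
    by exists p.2; rewrite ?orbE.
  by exists (1, i); rewrite ?orbE.
Qed.

(** Once a vertex [r i] is chosen in each orbit, semiregularity makes [(g, i) |-> f g (r i)] a
    bijection onto the vertices, and the arcs leaving [r i] give the connection sets. *)
Lemma POSR_haar_rep : admits_POSR #|I| [set: gT] ->
  exists T, haar_rep T.
Proof.
case=> V [arc] [P] [[irr anti] [partP cardP nP] isoA semireg orbE].
have /isogP[f injf imf] : [set: gT] \isog digraph_aut arc by rewrite isog_sym.
have fM x y v : f (x * y) v = f y (f x v) by rewrite morphM ?inE // permM.
have f_aut g : f g \in digraph_aut arc by rewrite -imf mem_morphim ?inE.
have f_arc g u v : arc (f g u) (f g v) = arc u v by apply/digraph_autP.
have [r rP r_inj] : exists2 r : I -> V,
    (forall v, exists i, v \in orbit 'P (digraph_aut arc) (r i)) &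
    (forall i j, r j \in orbit 'P (digraph_aut arc) (r i) -> i = j).
  (* [I] and [P] have equal cardinality, so their enumerations pair indices with orbits. *)
  pose B i : {set V} := enum_val (cast_ord (esym cardP) (enum_rank i)).
  have BP i : B i \in P by apply: enum_valP.
  have Brep i : {v | B i = orbit 'P (digraph_aut arc) v}.
    have := BP i; rewrite -orbE => /imsetP/sig2_eqW[v _ e].
    by exists v.
  exists (fun i => sval (Brep i)) => [v|i j].
    have: orbit 'P (digraph_aut arc) v \in P by rewrite -orbE imset_f.
    move=> vP.
    exists (enum_val (cast_ord cardP (enum_rank_in vP (orbit 'P (digraph_aut arc) v)))).
    rewrite -(svalP (Brep _)) /B enum_valK cast_ordK enum_rankK_in //.
    exact: orbit_refl.
  move=> /orbit_eqP; rewrite -!(svalP (Brep _)) => /esym/enum_val_inj.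
  by move/cast_ord_inj/enum_rank_inj.
pose phi (p : gT * I) := f p.1 (r p.2).
have phi_surj v : exists p, phi p = v.
  have [i] := rP v; rewrite -imf => /orbitP[s].
  rewrite morphimEdom => /imsetP[g _ ->] <-.
  by exists (g, i); rewrite /phi.
have phi_inj : injective phi.
  case=> g i [h j]; rewrite /phi /= => eq_gh.
  have eq_r : f (g * h^-1) (r i) = r j by rewrite fM eq_gh -fM mulgV morph1 perm1.
  have eqij : i = j.
    apply: r_inj; rewrite -eq_r; apply/orbitP; exists (f (g * h^-1)) => //.
  rewrite -eqij in eq_r *; congr pair.
  have: f (g * h^-1) \in 'C_(digraph_aut arc)[r i | 'P].
    by rewrite inE /= f_aut; apply/astab1P.
  rewrite (semireg (r i)) => /set1P; rewrite -(morph1 f).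
  by move/(injmP injf); rewrite !inE => /(_ isT isT)/eqP; rewrite -eq_mulgV1 => /eqP.
pose T i j := [set d | arc (r i) (f d (r j))].
have phi_arc p q : arc (phi p) (phi q) = haar_arc T p q.
  by rewrite /haar_arc inE -(f_arc p.1 (r p.2)) -fM mulgKV.
exists T; split.
- move=> i; apply/setP=> d; rewrite !inE; apply/negbTE.
  apply: (nP (orbit 'P (digraph_aut arc) (r i))).
  + by rewrite -orbE imset_f.
  + exact: orbit_refl.
  + by apply/orbitP; exists (f d).
- move=> i j d; rewrite !inE => adij; apply/negP=> adji.
  rewrite -(f_arc d) -fM mulVg morph1 perm1 in adji.
  have: r i != f d (r j).
    by apply: contraTneq adij => ->; rewrite (irr _).
  by move/anti; rewrite adij adji.
- move=> s /digraph_autP autS.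
  have [psi phiK psiK] : bijective phi.
    apply: (inj_card_bij phi_inj).
    rewrite -(card_codom phi_inj); apply: subset_leq_card.
    by apply/subsetP=> v _; have [p <-] := phi_surj v; apply: codom_f.
  have inj_s' : injective (phi \o s \o psi).
    by apply: inj_comp (can_inj psiK); apply: inj_comp perm_inj.
  have : perm inj_s' \in digraph_aut arc.
    apply/digraph_autP=> u v; rewrite !permE /= phi_arc autS -phi_arc.
    by rewrite !psiK.
  rewrite -imf morphimEdom => /imsetP[g _ /permP sE]; exists g => p.
  apply: phi_inj; have := sE (phi p); rewrite permE /= phiK => ->.
  by rewrite /phi /= fM.
Qed.

End HaarDigraph.

(** * Rigid colourings *)

Section Colorings.

Variable gT : finGroupType.
Implicit Types (H K : {group gT}) (c : gT -> option bool) (a b : gT -> gT).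

Definition color_auto (H : {set gT}) c a b : Prop :=
  [/\ {in H, forall g, a g \in H /\ b g \in H},
      {in H &, injective a}, {in H &, injective b}
    & {in H &, forall g h, c (b h * (a g)^-1) = c (h * g^-1)}].

(** Right translations preserve every colour; [a 1 = 1] normalises a colour automorphism modulo
    them. *)
Definition rigid (H : {set gT}) c : Prop :=
  forall a b, color_auto H c a b -> a 1 = 1 ->
    {in H, forall g, a g = g /\ b g = g}.

Definition color_class (H : {set gT}) c i := [set g in H | c g == i].

(* In [color_auto], [a] and [b] act on the two parts of the bipartite graph; the class
   [None] is connected as a bipartite graph on two copies of [H]. *)
Definition extendable H : Prop :=
  2 < #|H| /\ exists c,
    [/\ rigid H c,
        H \subset <<(color_class H c None)^-1 * color_class H c None>>,
        exists2 g, g \in H & c g = Some true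
      & exists i j, #|color_class H c i| != #|color_class H c j|].

(** The [d] in [H] that commute with [a] in this sense form a subgroup containing [D], hence all of
    [H]; then take [g = 1]. *)
Lemma left_equivariant_id H (D : {set gT}) a :
  {in H, forall g, a g \in H} -> D \subset H -> H \subset <<D>> ->
  {in D & H, forall d g, a (d * g) = d * a g} -> a 1 = 1 ->
  {in H, forall g, a g = g}.
Proof.
move=> aH sDH sHD aD a1.
pose S := [set d in H | [forall g in H, a (d * g) == d * a g]].
have SP d : reflect (d \in H /\ {in H, forall g, a (d * g) = d * a g}) (d \in S).
  rewrite inE; apply: (iffP andP) => -[-> h]; split=> //.
    by move=> g Hg; apply/eqP; apply: (forall_inP h).
  by apply/forall_inP=> g Hg; rewrite h.
have groupS : group_set S.
  apply/group_setP; split; first by apply/SP; split=> [|g _]; rewrite ?mul1g.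
  move=> x y /SP[Hx ax] /SP[Hy ay]; apply/SP; split=> [|g Hg].
    exact: groupM.
  by rewrite -!mulgA ax ?ay // groupM.
have sHS : H \subset Group groupS.
  apply: subset_trans sHD _; rewrite gen_subG; apply/subsetP=> d Dd.
  by apply/SP; split=> [|g Hg]; [apply: (subsetP sDH) | apply: aD].
move=> g Hg; have /SP[_ /(_ 1 (group1 H))] := subsetP sHS g Hg.
by rewrite mulg1 a1 mulg1.
Qed.

Definition shift_color (i : option bool) : option bool :=
  match i with None => Some false | Some false => Some true | Some true => None end.

Lemma shift_color_inj : injective shift_color.
Proof. by case=> [[]|] [[]|]. Qed.

(* On [H] the colours are rotated; outside [H], [x] joins the old class
   [Some false] and everything else joins the old class [Some true].
   The old connected class stays inside [H], so the cosets of [H] are blocks on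
   which rigidity applies, and [x] labels the only edges of its colour that
   leave a block. *)
Lemma extendable_join H x : extendable H -> x \notin H ->
  extendable (H <*> <[x]>).
Proof.
case=> H_gt2 [c [rigidH connH [g0 Hg0 cg0] _]] xH.
set K := (H <*> <[x]>)%G; have sHK : H \subset K by apply: joing_subl.
have Kx : x \in K by rewrite (subsetP (joing_subr _ _)) // cycle_id.
pose c' g := if g \in H then shift_color (c g)
             else if g == x then Some true else None.
have c'A g : (c' g == Some false) = (g \in H) && (c g == None).
  by rewrite /c'; case: (g \in H); [case: (c g) => [[]|] | case: (g == x)].
have /trivgPn[u Hu u1] : H :!=: 1 by rewrite -cardG_gt1 (ltnW H_gt2).
have c'H h : h \in H -> c' h = shift_color (c h) by rewrite /c' => ->.
have c'xH h : h \in H -> h != 1 -> c' (x * h) = None.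
  move=> Hh h1; rewrite /c' groupMr // (negPf xH).
  by rewrite -{2}[x]mulg1 (inj_eq (mulgI x)) (negPf h1).
have Kxh h : h \in H -> x * h \in K by move=> Hh; rewrite groupM // (subsetP sHK).
split; first by apply: leq_trans H_gt2 _; apply: subset_leq_card.
exists c'; split.
- move=> a b [abK a_inj b_inj abc] a1.
  have aK g : g \in K -> a g \in K by case/abK.
  have bK g : g \in K -> b g \in K by case/abK.
  set A := color_class H c None in connH.
  (* The new colour [Some false] is exactly the old class [A], which lies in [H], so edges of this
     colour stay inside a coset of [H]. *)
  have bA d g : d \in A -> g \in K -> b (d * g) * (a g)^-1 \in H.
    rewrite inE => /andP[Hd cd] Kg.
    have Kd := subsetP sHK d Hd.
    have : c' (b (d * g) * (a g)^-1) == Some false.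
      by rewrite abc ?groupM // mulgK c'A Hd.
    by rewrite c'A => /andP[].
  (* [S] is a subgroup; going to the other part and back along edges labelled in [A] shows that it
     contains [A^-1 * A], hence [H]. *)
  pose S := [set d in K | [forall g in K, a (d * g) * (a g)^-1 \in H]].
  have SP d : reflect (d \in K /\ {in K, forall g, a (d * g) * (a g)^-1 \in H}) (d \in S).
    rewrite inE; apply: (iffP andP) => -[-> h]; split=> //.
      by move=> g Kg; apply: (forall_inP h).
    by apply/forall_inP=> g Kg; rewrite h.
  have groupS : group_set S.
    apply/group_setP; split.
      by apply/SP; split=> [|g _]; rewrite ?mul1g ?mulgV.
    move=> d e /SP[Kd ad] /SP[Ke ae]; apply/SP; split=> [|g Kg].
      exact: groupM.
    rewrite -mulgA -(mulgKV (a (e * g)) (a (d * _))) -mulgA.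
    by rewrite groupM ?ae // ad ?groupM.
  have sHS : H \subset Group groupS.
    apply: subset_trans connH _; rewrite gen_subG.
    apply/subsetP=> _ /mulsgP[d e Ad Ae ->]; rewrite inE in Ad.
    have [Kd Ke] : d \in K /\ e \in K.
      move: Ad Ae; rewrite !inE groupV => /andP[? _] /andP[? _].
      by rewrite !(subsetP sHK).
    suff: d * e \in S by [].
    apply/SP; split=> [|g Kg]; first exact: groupM.
    have h1 : b (e * g) * (a (d * e * g))^-1 \in H.
      by have := bA d^-1 (d * e * g) Ad; rewrite -mulgA mulKg; apply; rewrite !groupM.
    have := groupM (groupVr h1) (bA e g Ae Kg).
    by rewrite invMg invgK mulgA mulgKV.
  have aH h g : h \in H -> g \in K -> a (h * g) * (a g)^-1 \in H.
    by move=> Hh Kg; have /SP[_ /(_ g Kg)] := subsetP sHS h Hh.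
  have [d Ad] : exists d, d \in A.
    have [A0|[d Ad]] := set_0Vmem A; last by exists d.
    have /(subsetP connH) := Hu; suff /trivgP-> : <<A^-1 * A>> \subset [1].
      by rewrite inE (negPf u1).
    by rewrite gen_subG; apply/subsetP=> y /mulsgP[? v _ Av _]; rewrite A0 inE in Av.
  have Hd : d \in H by have := Ad; rewrite inE => /andP[].
  have bH h g : h \in H -> g \in K -> b (h * g) * (a g)^-1 \in H.
    move=> Hh Kg; have Hdh : d^-1 * h \in H by rewrite groupM ?groupV.
    have h1 := bA d _ Ad (groupM (subsetP sHK _ Hdh) Kg).
    rewrite -[d^-1 * h * g]mulgA mulKVg mulgA in h1.
    by have := groupM h1 (aH _ _ Hdh Kg); rewrite mulgA mulgKV.
  (* Restricted to the block [H g] and divided by [a g], the pair becomes a colour automorphism of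
     [H] fixing 1, so rigidity of [c] applies. *)
  have blockH h g : h \in H -> g \in K -> a (h * g) = h * a g /\ b (h * g) = h * a g.
    move=> Hh Kg.
    have Khg k : k \in H -> k * g \in K.
      by move=> Hk; rewrite groupM // (subsetP sHK).
    pose a' k := a (k * g) * (a g)^-1; pose b' k := b (k * g) * (a g)^-1.
    have a'1 : a' 1 = 1 by rewrite /a' mul1g mulgV.
    suff a'b' : color_auto H c a' b'.
      have [e1 e2] := rigidH a' b' a'b' a'1 h Hh.
      by split; [rewrite -{2}e1 | rewrite -{2}e2]; rewrite /a' /b' mulgKV.
    split=> [k Hk|k l Hk Hl /mulIg|k l Hk Hl /mulIg|k l Hk Hl].
    + by rewrite aH ?bH.
    + by move/a_inj; rewrite !Khg // => /(_ isT isT)/mulIg.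
    + by move/b_inj; rewrite !Khg // => /(_ isT isT)/mulIg.
    + have := abc (k * g) (l * g); rewrite !Khg // => /(_ isT isT).
      rewrite invMg mulgA mulgK => e.
      have [Ha Hb] : a' k \in H /\ b' l \in H by rewrite /a' /b' aH ?bH.
      apply: shift_color_inj; rewrite -!c'H ?(groupM Hb) ?(groupM Hl) ?groupV // -e.
      by rewrite /a' /b' invMg invgK mulgA mulgKV.
  have ba g : g \in K -> b g = a g.
    by move=> Kg; case: (blockH 1 g) => //; rewrite !mul1g.
  (* Outside [H] only [x] has its colour; a quotient inside [H] would, by [blockH] and injectivity,
     put [x] in [H]. *)
  have ax g : g \in K -> a (x * g) = x * a g.
    move=> Kg; have := abc g (x * g) Kg (groupM Kx Kg).
    rewrite mulgK ba ?groupM // /c' (negPf xH) eqxx.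
    case: ifP => [Hax _|_].
      have [e _] := blockH _ _ Hax Kg; rewrite mulgKV in e.
      have /mulIg ex := a_inj _ _ (groupM (subsetP sHK _ Hax) Kg) (groupM Kx Kg) e.
      by rewrite -ex Hax in xH.
    by case: eqP => // e _; rewrite -{2}e mulgKV.
  have aid : {in K, forall g, a g = g}.
    apply: (@left_equivariant_id K (x |: H)) => //.
    + by rewrite subUset sub1set Kx.
    + by rewrite join_subG cycle_subG mem_gen ?setU11 // sub_gen // subsetUr.
    + move=> y g; rewrite !inE => /predU1P[->|Hy] Kg; first exact: ax.
      by have [] := blockH y g Hy Kg.
  by move=> g Kg; rewrite ba ?aid.
- set D := _^-1 * _.
  have DP d e : d \in K -> e \in K -> c' d = None -> c' e = None ->
      d^-1 * e \in <<D>>.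
    by move=> Kd Ke cd ce; apply/mem_gen/mem_mulg; rewrite !inE ?invgK ?Kd ?Ke ?cd ?ce.
  have sHD : H \subset <<D>>.
    apply/subsetP=> h Hh.
    (* Avoiding 1 and [h^-1] keeps [x * h1] and [x * (h1 * h)] different from [x], hence in the
       class [None]; this uses [2 < #|H|]. *)
    have /subsetPn[h1 Hh1] : ~~ (H \subset [set 1; h^-1]).
      apply: contraL H_gt2 => /subset_leq_card/leq_trans; rewrite -leqNgt; apply.
      by rewrite cards2; case: eqP.
    rewrite !inE negb_or => /andP[h1n1 h1nh].
    have -> : h = (x * h1)^-1 * (x * (h1 * h)) by rewrite invMg -mulgA mulKg mulKg.
    apply: DP; rewrite ?Kxh ?c'xH ?groupM //.
    by apply: contraNneq h1nh => /(canRL (mulgK h)); rewrite mul1g => ->.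
  (* Here [x = g0 * (g0^-1 * (x * u)) * u^-1], where [g0] and [x * u] both have new colour
     [None]. *)
  rewrite join_subG sHD cycle_subG /= -(mulgK u x) -(mulKVg g0 (x * u)).
  rewrite groupM ?groupV ?(subsetP sHD _ Hu) // groupM ?(subsetP sHD _ Hg0) //.
  by apply: DP; rewrite ?Kxh ?(subsetP sHK) ?c'xH ?c'H ?cg0.
- by exists x => //; rewrite /c' (negPf xH) eqxx.
(* The class [None] contains [g0] and [x *: (H :\ 1)], so at least [#|H|] elements, while
   [Some false] lies in [H] and misses [g0]. *)
- exists None, (Some false); rewrite neq_ltn; apply/orP; right.
  have lt : #|color_class K c' (Some false)| < #|H|.
    apply: proper_card; apply/properP; split; last first.
      by exists g0; rewrite // inE c'A cg0 !andbF.
    by apply/subsetP=> g; rewrite inE c'A => /and3P[].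
  apply: leq_trans lt _; rewrite (cardsD1 1 H) group1 add1n -(card_lcoset (H :\ 1) x).
  have <- : #|g0 |: x *: (H :\ 1)| = #|x *: (H :\ 1)|.+1.
    by rewrite cardsU1 mem_lcoset !inE groupMr // groupV (negPf xH) andbF.
  apply: subset_leq_card; apply/subsetP=> g; rewrite !inE mem_lcoset !inE.
  case/predU1P=> [->|/andP[g1 Hg]]; first by rewrite (subsetP sHK) // c'H ?cg0.
  by rewrite -(mulKVg x g) Kxh ?c'xH.
Qed.

Lemma extendable_setT H : extendable H -> extendable [set: gT].
Proof.
move: {2}(#|gT| - #|H|) (leqnn (#|gT| - #|H|)) => n; elim: n H => [|n IHn] H.
  rewrite leqn0 subn_eq0 -cardsT => le extH.
  suff -> : [set: gT]%G = H by [].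
  by apply/esym/val_inj/eqP; rewrite /= eqEcard subsetT.
move=> le extH; have [sTH|/subsetPn[x _ xH]] := boolP ([set: gT] \subset H).
  suff -> : [set: gT]%G = H by [].
  by apply/esym/val_inj/eqP; rewrite /= eqEsubset subsetT.
apply: (IHn (H <*> <[x]>)%G); last exact: extendable_join.
have lt : #|H| < #|H <*> <[x]>|.
  apply: proper_card; rewrite properE joing_subl join_subG subxx cycle_subG.
  exact: xH.
have : #|H <*> <[x]>| <= #|gT| by apply: max_card.
move: le lt; case: #|gT| => [|N]; first by rewrite leqn0 => _ lt /eqP e; rewrite e in lt.
move=> le lt le2; rewrite -ltnS; apply: leq_trans _ le; rewrite ltn_sub2l //.
exact: leq_trans lt le2.
Qed.

End Colorings.

(** * Base cases: cyclic groups, and groups generated by elements of orders 3 and 2 *)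

Section Bases.

Variable gT : finGroupType.
Implicit Types (H K : {group gT}) (c : gT -> option bool) (a b : gT -> gT).

(* Colouring the identity alone makes the class [Some false] a perfect
   matching, which identifies the two parts. *)
Lemma color_auto_matching H c a b :
  {in H, forall g, (c g == Some false) = (g == 1)} -> color_auto H c a b ->
  {in H, forall g, b g = a g}.
Proof.
move=> c1 [abH _ _ abc] g Hg; have [aH bH] := abH g Hg.
have : c (b g * (a g)^-1) == Some false by rewrite abc // mulgV c1 ?group1.
by rewrite c1 ?groupM ?groupV // -eq_mulgV1 => /eqP.
Qed.

Lemma color_class_matching H c :
  {in H, forall g, (c g == Some false) = (g == 1)} ->
  color_class H c (Some false) = [set 1].
Proof.
move=> c1; apply/setP=> g; rewrite !inE; have [Hg|nHg] := boolP (g \in H).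
  exact: c1.
by apply/esym/negbTE; apply: contraNneq nHg => ->.
Qed.

(** Giving [y] a colour of its own forces equivariance under the generator. The order bound puts
    [y ^+ 2] and [y ^+ 3] in the class [None], and their quotient [y] makes it connected. *)
Lemma extendable_cycle (y : gT) : 3 < #[y] -> extendable <[y]>%G.
Proof.
move=> y_gt3; set H := <[y]>%G.
have yX n : 0 < n < 4 -> y ^+ n != 1.
  case/andP=> n0 n4; rewrite -order_dvdn gtnNdvd //.
  exact: leq_trans n4 y_gt3.
have y1 : y != 1 by apply: (yX 1%N).
have Hy : y \in H by apply: cycle_id.
pose c g := if g == 1 then Some false else if g == y then Some true else None.
have c1 : {in H, forall g, (c g == Some false) = (g == 1)}.
  by move=> g _; rewrite /c; case: (g == 1) => //; case: ifP.
have c2 : c (y ^+ 2) = None.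
  rewrite /c (negPf (yX 2 _)) // expgS expg1.
  by rewrite -{3}[y]mulg1 (inj_eq (mulgI y)) (negPf y1).
have c3 : c (y ^+ 3) = None.
  rewrite /c (negPf (yX 3 _)) // expgS.
  by rewrite -{3}[y]mulg1 (inj_eq (mulgI y)) (negPf (yX 2 _)).
split; first exact: ltnW.
exists c; split.
- move=> a b abP a1; have ba := color_auto_matching c1 abP.
  case: abP => abH a_inj _ abc.
  have aid : {in H, forall g, a g = g}.
    apply: (@left_equivariant_id _ H [set y]) => //.
    + by move=> g /abH[].
    + by rewrite sub1set.
    + move=> _ g /set1P-> Hg; have := abc g (y * g) Hg (groupM Hy Hg).
      rewrite mulgK ba ?groupM // /c eqxx (negPf y1).
      by case: eqP => // _; case: eqP => // /(canRL (mulgKV _)).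
  by move=> g Hg; rewrite ba ?aid.
- rewrite cycle_subG; apply: mem_gen; rewrite -{1}(mulKg (y ^+ 2) y) -expgSr.
  by apply: mem_mulg; rewrite !inE ?invgK ?groupX //= ?c2 ?c3.
- by exists y; rewrite // /c eqxx (negPf y1).
- exists (Some false), None; rewrite neq_ltn; apply/orP; left.
  rewrite (color_class_matching c1) cards1.
  have <- : #|[set y ^+ 2; y ^+ 3]| = 2.
    rewrite cards2 -{1}[y ^+ 2]mulg1 [y ^+ 3]expgSr (inj_eq (mulgI _)).
    by rewrite eq_sym y1.
  apply: subset_leq_card; apply/subsetP=> g /set2P[]->;
    by rewrite inE groupX ?c2 ?c3.
Qed.

(** [x] and [y] share a colour, but reversing an edge tells them apart: [y^-1 = y] keeps the colour
    while [x^-1] has colour [None]. Once [x] is respected, injectivity leaves only [y] as image of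
    [y]. *)
Lemma extendable_order23 (x y : gT) : #[x] = 3 -> #[y] = 2 ->
  extendable (<[x]> <*> <[y]>)%G.
Proof.
move=> ox oy; set H := (_ <*> _)%G.
have Hx : x \in H by rewrite (subsetP (joing_subl _ _)) ?cycle_id.
have Hy : y \in H by rewrite (subsetP (joing_subr _ _)) ?cycle_id.
have xn1 : x != 1 by rewrite -order_eq1 ox.
have yn1 : y != 1 by rewrite -order_eq1 oy.
have xy : x != y by apply: contra_eqN oy => /eqP<-; rewrite ox.
have x3 : x ^+ 3 = 1 by rewrite -ox expg_order.
have y2 : y * y = 1 by have := expg_order y; rewrite oy.
have xVn1 : x^-1 != 1 by rewrite invg_eq1.
have xVx : x^-1 != x.
  apply: contra_eqN x3 => /eqP e; rewrite !expgS expg0 mulg1.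
  by rewrite -{2}e mulVg mulg1.
have xVy : x^-1 != y by apply: contra_eqN oy => /eqP<-; rewrite orderV ox.
pose c g := if g == 1 then Some false
  else if (g == x) || (g == y) then Some true else None.
have c1 : {in H, forall g, (c g == Some false) = (g == 1)}.
  by move=> g _; rewrite /c; case: (g == 1) => //; case: ifP.
have cx : c x = Some true by rewrite /c (negPf xn1) eqxx.
have cy : c y = Some true by rewrite /c (negPf yn1) eqxx orbT.
have cxV : c x^-1 = None by rewrite /c (negPf xVn1) (negPf xVx) (negPf xVy).
have cT g : c g = Some true -> g = x \/ g = y.
  by rewrite /c; case: ifP => // _; case: ifP => // /orP[] /eqP; [left|right].
have cyx z : z != 1 -> y * z != x -> y * z != 1 -> c (y * z) = None.
  move=> z1 yzx yz1; rewrite /c (negPf yz1) (negPf yzx) /=.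
  by rewrite -{2}[y]mulg1 (inj_eq (mulgI y)) (negPf z1).
have cyx1 : c (y * x) = None.
  apply: cyx => //.
    by rewrite -{2}[x]mul1g (inj_eq (mulIg x)).
  by apply: contraNneq xVy => /(canRL (mulgK x)); rewrite mul1g => ->.
have cyxV : c (y * x^-1) = None.
  apply: cyx => //; last by rewrite -eq_mulgV1 eq_sym.
  apply: contra_eqN oy => /eqP/(canRL (mulgKV x)) e.
  rewrite (_ : y = x^-1) ?orderV ?ox // e.
  by apply: (mulgI x); rewrite mulgV mulgA -x3 !expgS expg0 mulg1 mulgA.
split.
  by rewrite -ox -[#[x]]/(#|<[x]>|); apply: subset_leq_card; apply: joing_subl.
exists c; split.
- move=> a b abP a1; have ba := color_auto_matching c1 abP.
  case: abP => abH a_inj _ abc.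
  have acc g h : g \in H -> h \in H -> c (a h * (a g)^-1) = c (h * g^-1).
    by move=> Hg Hh; rewrite -(ba h Hh) abc.
  have ax g : g \in H -> a (x * g) = x * a g.
    move=> Hg; have := acc g (x * g) Hg (groupM Hx Hg).
    rewrite mulgK cx => /cT[] /(canRL (mulgKV _)) // axy.
    have := acc (x * g) g (groupM Hx Hg) Hg.
    rewrite axy !invMg !mulgA !mulgV !mul1g cxV.
    by rewrite (_ : y^-1 = y) ?cy //; apply: (mulgI y); rewrite mulgV y2.
  have aid : {in H, forall g, a g = g}.
    apply: (@left_equivariant_id _ H [set x; y]) => //.
    + by move=> g /abH[].
    + by rewrite subUset !sub1set Hx.
    + by rewrite join_subG !cycle_subG !mem_gen // !inE eqxx ?orbT.
    + move=> _ g /set2P[]-> Hg; first exact: ax.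
      have := acc g (y * g) Hg (groupM Hy Hg).
      rewrite mulgK cy => /cT[] /(canRL (mulgKV _)) //; rewrite -ax // => /a_inj.
      rewrite !groupM // => /(_ isT isT)/mulIg e.
      by rewrite e eqxx in xy.
  by move=> g Hg; rewrite ba ?aid.
- set D := _^-1 * _.
  have DP d e : d \in H -> e \in H -> c d = None -> c e = None ->
      d^-1 * e \in <<D>>.
    by move=> Hd He cd ce; apply/mem_gen/mem_mulg; rewrite !inE ?invgK ?Hd ?He ?cd ?ce.
  (* The quotient of [y * x^-1] and [y * x] is [x * x = x^-1]. *)
  have Dx : x \in <<D>>.
    have e : x * x = x^-1.
      by apply: (mulgI x); rewrite mulgV -x3 !expgS expg0 mulg1.
    rewrite -groupV -e.
    have := DP (y * x^-1) (y * x); rewrite invMg invgK mulgA mulgKV.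
    by apply; rewrite ?groupM ?groupV.
  rewrite join_subG !cycle_subG Dx /=.
  have := DP x^-1 (y * x) (groupVr Hx) (groupM Hy Hx) cxV cyx1.
  rewrite invgK mulgA.
  by rewrite groupMr // groupMl.
- by exists x.
- exists (Some false), (Some true).
  rewrite (color_class_matching c1) cards1.
  have -> : color_class H c (Some true) = [set x; y].
    apply/setP=> g; rewrite !inE; apply/andP/orP=> [[_ /eqP/cT[]->]|[]/eqP->].
    + by left.
    + by right.
    + by rewrite Hx cx.
    + by rewrite Hy cy.
  by rewrite cards2 xy.
Qed.

End Bases.

Lemma isog_extendable (gT rT : finGroupType) (G : {group gT}) (H : {group rT}) :
  G \isog H -> extendable G -> extendable H.
Proof.
move=> isoGH [G_gt2 [c [rigidG connG [g0 Gg0 cg0] [i [j cij]]]]].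
have cardGH := card_isog isoGH; case/isogP: isoGH => f injf imf.
pose k := invm injf.
have Gk h : h \in H -> k h \in G.
  by rewrite -imf => Hh; have := mem_morphim (invm injf) Hh Hh; rewrite im_invm.
have fk h : h \in H -> f (k h) = h by rewrite -imf => Hh; apply: invmK.
have kf g : g \in G -> k (f g) = g by apply: invmE.
have Hf g : g \in G -> f g \in H by move=> Gg; rewrite -imf mem_morphim.
have kM x y : x \in H -> y \in H -> k (x * y) = k x * k y.
  by rewrite -imf; apply: morphM.
have kV x : x \in H -> k x^-1 = (k x)^-1 by rewrite -imf; apply: morphV.
have k1 : k 1 = 1 by apply: morph1.
have k_inj : {in H &, injective k}.
  by move=> x y Hx Hy e; rewrite -[x]fk // e fk.
have classE l : color_class H (c \o k) l = f @* color_class G c l.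
  apply/setP=> h; apply/idP/morphimP=> [|[g Gg]]; rewrite !inE.
    by case/andP=> Hh ch; exists (k h); rewrite ?inE ?fk ?Gk.
  by case/andP=> _ cg ->; rewrite Hf //= kf.
have sclassG l : color_class G c l \subset G.
  by apply/subsetP=> g /setIdP[].
split; first by rewrite -cardGH.
exists (c \o k); split.
- move=> a b [abH a_inj b_inj abc] a1.
  pose a' := k \o a \o f; pose b' := k \o b \o f.
  have abP : color_auto G c a' b'.
    split=> [g Gg|x y Gx Gy|x y Gx Gy|x y Gx Gy].
    + by have [Ha Hb] := abH _ (Hf g Gg); rewrite /= !Gk.
    + have [[Hax _] [Hay _]] := (abH _ (Hf x Gx), abH _ (Hf y Gy)).
      move/(k_inj _ _ Hax Hay)/(a_inj _ _ (Hf x Gx) (Hf y Gy)) => e.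
      by rewrite -[x]kf // e kf.
    + have [[_ Hax] [_ Hay]] := (abH _ (Hf x Gx), abH _ (Hf y Gy)).
      move/(k_inj _ _ Hax Hay)/(b_inj _ _ (Hf x Gx) (Hf y Gy)) => e.
      by rewrite -[x]kf // e kf.
    + have [[Hax _] [_ Hby]] := (abH _ (Hf x Gx), abH _ (Hf y Gy)).
      have := abc _ _ (Hf x Gx) (Hf y Gy); rewrite /= -kV // -kM ?groupV // => ->.
      by rewrite kM ?groupV ?kV ?Hf // !kf.
  have a'1 : a' 1 = 1 by rewrite /a' /= morph1 a1 k1.
  move=> h Hh; have [] := rigidG a' b' abP a'1 (k h) (Gk h Hh).
  have [Ha Hb] := abH h Hh.
  by rewrite /a' /b' /= fk // => /k_inj-> // /k_inj->.
- have sVG : (color_class G c None)^-1 \subset G.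
    by rewrite -invSg invgK invGid sclassG.
  rewrite classE -imf -morphimV -morphimMl // -morphim_gen ?morphimS //.
  by apply: subset_trans (mulgSS sVG (sclassG None)) _; rewrite mulGid.
- by exists (f g0); rewrite ?Hf //= kf.
- by exists i, j; rewrite !classE !card_injm ?sclassG.
Qed.

(** * Rigidity by finite computation *)

Section Table.

Variables (gT : finGroupType) (els D : seq gT) (c : gT -> option bool).

(** For two vertices of the first part with quotient [d], this counts the vertices of the second
    part joined to them in colours [i] and [j]. *)
Definition pair_count d i j := count (fun h => (c h == i) && (c (h * d^-1) == j)) els.

(** A computable lower bound for the generated subgroup: ordered products over subsequences of [s].
    Repeating a list, as in [D ++ D], reaches more elements. *)
Definition subproducts (s : seq gT) :=
  foldr (fun d acc => undup (acc ++ [seq d * x | x <- acc])) [:: 1] s.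

Lemma subproducts_gen (s : seq gT) (A : {set gT}) :
  {subset s <= A} -> {subset subproducts s <= <<A>>}.
Proof.
elim: s => [_ x|d s IHs sA x] /=; first by rewrite inE => /eqP->; apply: group1.
have {}IHs : {subset subproducts s <= <<A>>}.
  by apply: IHs => y sy; apply: sA; rewrite inE sy orbT.
rewrite mem_undup mem_cat => /orP[/IHs //|/mapP[y /IHs Ay ->]].
by rewrite groupM // mem_gen // sA ?inE ?eqxx.
Qed.

Definition all_colors := [:: None; Some false; Some true].

Lemma mem_all_colors i : i \in all_colors.
Proof. by case: i => [[]|]. Qed.

Definition pair_count_le d e :=
  all (fun i => all (fun j => pair_count d i j <= pair_count e i j) all_colors)
      all_colors.

(* [pair_count d i j] depends only on [d] and is preserved by automorphisms, so
   elements [d] with a distinguished count vector are respected by left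
   multiplication; rigidity follows when they generate the group. *)
Definition table_check :=
  [&& uniq els,
      all (fun d => all (fun e => pair_count_le d e ==> (e == d)) els) D,
      all (mem (subproducts (D ++ D))) els,
      all (fun u => (u == 1) || has (fun h => c (u * h) != c h) els) els
    & let s := [seq h <- els | c h == None] in
      let t := [seq (head 1 s)^-1 * h | h <- s] in
      all (mem (subproducts (t ++ t))) els].

Hypothesis elsP : forall g, g \in els.

Lemma count_els (p : pred gT) : uniq els -> count p els = #|[set g | p g]|.
Proof.
move=> els_uniq; rewrite -size_filter cardE; apply/perm_size/uniq_perm.
- by rewrite filter_uniq.
- exact: enum_uniq.
- by move=> x; rewrite mem_enum mem_filter elsP inE andbT.
Qed.

(** [b] maps the vertices counted for [g] and [h] injectively to those counted for [a g] and
    [a h]. *)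
Lemma pair_count_auto a b g h : uniq els ->
  color_auto [set: gT] c a b ->
  pair_count_le (h * g^-1) (a h * (a g)^-1).
Proof.
move=> els_uniq [_ _ b_inj abc]; apply/allP=> i _; apply/allP=> j _.
have countE u v : pair_count (v * u^-1) i j =
    #|[set x | (c (x * u^-1) == i) && (c (x * v^-1) == j)]|.
  rewrite -(card_imset _ (mulIg u^-1)) /pair_count count_els //.
  apply: eq_card => x; rewrite inE invMg invgK mulgA.
  apply/idP/imsetP=> [/andP[ci cj]|[y]]; last by rewrite inE => ? ->; rewrite mulgKV.
  by exists (x * u); rewrite ?inE mulgK ?ci.
rewrite !countE -(card_imset _ (_ : injective b)); last first.
  by move=> x y; apply: b_inj; rewrite inE.
apply/subset_leq_card/subsetP=> _ /imsetP[x + ->].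
by rewrite !inE !abc ?inE.
Qed.

Lemma table_extendable : 2 < #|[set: gT]| -> table_check ->
  (exists g, c g = Some true) ->
  (exists i j, count (fun g => c g == i) els != count (fun g => c g == j) els) ->
  extendable [set: gT].
Proof.
move=> gt2 /and5P[els_uniq /allP Duniq /allP Dgen /allP aper /allP conn] [g0 cg0].
case=> i [j cij].
have countE l : count (fun g => c g == l) els = #|color_class [set: gT] c l|.
  by rewrite count_els //; apply: eq_card => g; rewrite !inE.
split=> //; exists c; split.
- move=> a b abP a1.
  have aid : {in [set: gT], forall g, a g = g}.
    apply: (@left_equivariant_id _ _ [set d in D]) => //.
    + by move=> g _; rewrite inE.
    + exact: subsetT.
    + apply/subsetP=> g _; have : g \in subproducts (D ++ D) by apply: Dgen.
      by apply: subproducts_gen => d; rewrite mem_cat orbb inE.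
    + move=> d g; rewrite inE => Dd _.
      have /allP/(_ _ (elsP (a (d * g) * (a g)^-1))) := Duniq d Dd.
      have := pair_count_auto g (d * g) els_uniq abP; rewrite mulgK => -> /= /eqP.
      by move/(canRL (mulgKV _)).
  move=> g gT_g; rewrite aid //; split=> //.
  (* With [a] the identity, [b g * g^-1] is a left period of [c], and the table excludes nontrivial
     ones. *)
  have /orP[/eqP|/hasP[h _]] := aper (b g * g^-1) (elsP _).
    by move/(canRL (mulgKV _)); rewrite mul1g.
  case: abP => _ _ _ abc; have := abc (h^-1 * g) g; rewrite !inE => /(_ isT isT).
  by rewrite aid ?inE // !invMg !invgK !mulgA mulgV mul1g => ->; rewrite eqxx.
- apply/subsetP=> g _; set s := [seq h <- els | c h == None] in conn.
  set t := [seq (head 1 s)^-1 * h | h <- s] in conn.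
  have : g \in subproducts (t ++ t) by apply: conn.
  apply: subproducts_gen => d; rewrite mem_cat orbb => /mapP[h sh ->].
  have : head 1 s \in s by move: sh; case: (s) => //= z r _; rewrite inE eqxx.
  move: sh; rewrite !mem_filter => /andP[ch _] /andP[cz _].
  by apply: mem_mulg; rewrite !inE ?invgK.
- by exists g0; rewrite ?inE.
- by exists i, j; rewrite -!countE.
Qed.

End Table.

Lemma Zp2P (i : 'Z_2) : i = 0%R \/ i = 1%R.
Proof. by case: i => [[|[|//]] lti]; [left | right]; apply/val_inj. Qed.

Lemma Zp3P (i : 'Z_3) : [\/ i = 0%R, i = 1%R | i = 2%:R%R].
Proof.
by case: i => [[|[|[|//]]] lti]; [constructor 1 | constructor 2 | constructor 3];
  apply/val_inj.
Qed.

(* The colourings of the next two lemmas were found by computer search: these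
   groups have no digraphical regular representation, so no class can be a
   perfect matching. *)
Lemma extendable_Z33 : extendable [set: 'Z_3 * 'Z_3].
Proof.
pose e3 : seq 'Z_3 := [:: 0; 1; 2%:R]%R.
pose els : seq ('Z_3 * 'Z_3) := [seq (i, j) | i <- e3, j <- e3].
pose c (g : 'Z_3 * 'Z_3) : option bool :=
  nth None [:: Some false; Some false; None; Some true; Some true; None;
               Some true; None; None] (3 * (g.1 : nat) + (g.2 : nat))%N.
apply: (@table_extendable _ els [:: (1, 0); (1, 2%:R)]%R c).
- case=> i j; move: (Zp3P i) (Zp3P j).
  by do 2![case=> ->]; vm_compute.
- by rewrite cardsT card_prod !card_ord.
- by vm_compute.
- by exists (1, 0)%R.
- by exists None, (Some false); vm_compute.
Qed.

Lemma extendable_Z2222 : extendable [set: 'Z_2 * 'Z_2 * 'Z_2 * 'Z_2].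
Proof.
pose e2 : seq 'Z_2 := [:: 0; 1]%R.
pose els : seq ('Z_2 * 'Z_2 * 'Z_2 * 'Z_2) :=
  [seq (h, l) | h <- [seq (g, k) | g <- [seq (i, j) | i <- e2, j <- e2], k <- e2],
                l <- e2].
pose c (g : 'Z_2 * 'Z_2 * 'Z_2 * 'Z_2) : option bool :=
  let n := (8 * (g.1.1.1 : nat) + 4 * (g.1.1.2 : nat) + 2 * (g.1.2 : nat)
            + (g.2 : nat))%N in
  if n \in [:: 0; 5; 12; 14]%N then Some false
  else if n \in [:: 1; 2; 6; 8; 9; 10]%N then Some true else None.
apply: (@table_extendable _ els
  [:: (0, 0, 0, 1); (0, 0, 1, 1); (0, 1, 0, 0); (1, 0, 0, 0)]%R c).
- case=> [[[i j] k] l]; move: (Zp2P i) (Zp2P j) (Zp2P k) (Zp2P l).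
  by do 4![case=> ->]; vm_compute.
- by rewrite cardsT !card_prod !card_ord.
- by vm_compute.
- by exists (0, 0, 0, 1)%R.
- by exists None, (Some false); vm_compute.
Qed.

(** * Adding parts *)

Section Representations.

Variable gT : finGroupType.

Section Sinks.

Variables (I : finType) (T : I -> I -> {set gT}).

(** The invariant for adding parts: a matching from part [i0] to a new part leaves no sinks among
    the old vertices. *)
Definition sinks_in_one_part : Prop :=
  exists i0, forall i, i != i0 -> exists j, T i j != set0.

Lemma haar_outdegree p :
  #|[set q | haar_arc T p q]| = \sum_j #|T p.2 j|.
Proof.
rewrite -sum1_card (partition_big (fun q => q.2) xpredT) //=.
apply: eq_bigr => j _; rewrite sum1_card.
have inj : injective (fun d : gT => (d * p.1, j)) by move=> x y [/mulIg].
rewrite -(card_imset _ inj); apply: eq_card => -[x i]; apply/andP/imsetP.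
  rewrite inE /haar_arc /= => -[Tx /eqP /= eij]; rewrite eij in Tx.
  by exists (x * p.1^-1); rewrite ?mulgKV ?eij.
by case=> d Td [-> ->]; rewrite inE /haar_arc /= mulgK.
Qed.

Lemma haar_aut_outdegree s p : s \in digraph_aut (haar_arc T) ->
  \sum_j #|T (s p).2 j| = \sum_j #|T p.2 j|.
Proof.
move=> /digraph_autP sP; rewrite -!haar_outdegree -[RHS](card_imset _ (@perm_inj _ s)).
apply: eq_card => q; rewrite inE; apply/idP/imsetP => [spq|[r]].
  by exists (s^-1 q); rewrite ?permKV // inE -sP permKV.
by rewrite inE => pr ->; rewrite sP.
Qed.

Definition add_sink (i0 : I) (i j : option I) : {set gT} :=
  match i, j with
  | Some i, Some j => T i j
  | Some i, None => if i == i0 then [set 1] else set0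
  | None, _ => set0
  end.

End Sinks.

(** The new part consists of all sinks, so automorphisms preserve it and restrict to translations of
    the old digraph; the matching carries the translation to the new part. *)
Lemma add_sink_rep (I : finType) (T : I -> I -> {set gT}) :
  haar_rep T -> sinks_in_one_part T ->
  exists T' : option I -> option I -> {set gT},
    haar_rep T' /\ sinks_in_one_part T'.
Proof.
move=> [T0 Tanti autT] [i0 Ti0]; exists (add_sink T i0); split; last first.
  exists None => -[i|//] _; have [->|/Ti0[j Tij]] := eqVneq i i0.
    by exists None; rewrite /= eqxx -card_gt0 cards1.
  by exists (Some j).
have nonsink i : exists j, add_sink T i0 (Some i) j != set0.
  have [->|/Ti0[j Tij]] := eqVneq i i0.
    by exists None; rewrite /= eqxx -card_gt0 cards1.
  by exists (Some j).
split=> [[i|]//=|[i|] [j|] d /=|s sP].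
- exact: Tanti.
- by rewrite inE.
- by rewrite inE.
- by rewrite inE.
have s_sink p : ((s p).2 == None) = (p.2 == None).
  have sinkE q : (q.2 == None :> option I) = (\sum_j #|add_sink T i0 q.2 j| == 0%N).
    rewrite sum_nat_eq0; case: q => x [i|] /=; last first.
      by apply/esym/forallP=> j; rewrite cards0.
    have [j Tj] := nonsink i; apply/esym/negbTE/forallPn; exists j.
    by rewrite cards_eq0.
  by rewrite !sinkE haar_aut_outdegree.
(* The default is never reached, since [s] maps old vertices to old vertices. *)
pose s' (p : gT * I) := ((s (p.1, Some p.2)).1, odflt p.2 (s (p.1, Some p.2)).2).
have s'E p : s (p.1, Some p.2) = ((s' p).1, Some (s' p).2).
  rewrite /s' /=; have := s_sink (p.1, Some p.2).
  by case: (s _) => x [i|].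
have s'_inj : injective s'.
  move=> p q e; have := s'E p; rewrite e -s'E => /perm_inj[].
  by case: (p) (q) => ? ? [? ?] /= -> ->.
have autP := digraph_autP _ _ sP.
have : perm s'_inj \in digraph_aut (haar_arc T).
  apply/digraph_autP=> p q; rewrite !permE.
  have := autP (p.1, Some p.2) (q.1, Some q.2).
  by rewrite !s'E.
case/autT=> g gP; exists g.
have sSome h i : s (h, Some i) = (h * g, Some i).
  by rewrite (s'E (h, i)) -(permE s'_inj) gP.
case=> h [i|] /=; first exact: sSome.
have := autP (h, Some i0) (h, None); have := s_sink (h, None).
rewrite sSome; case: (s _) => x [i|] //= _.
by rewrite /haar_arc /= eqxx mulgV set11 inE -eq_mulgV1 => /eqP->.
Qed.

(** Two classes of different sizes serve as forward and backward arcs, so out-degrees distinguish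
    the parts and every automorphism yields a colour automorphism. *)
Lemma rigid_rep (c : gT -> option bool) : rigid [set: gT] c ->
  (exists i j, #|color_class [set: gT] c i| != #|color_class [set: gT] c j|) ->
  exists T : bool -> bool -> {set gT}, haar_rep T /\ sinks_in_one_part T.
Proof.
move=> rigidc [i [j cij]].
have neij : i != j by apply: contraNneq cij => ->.
pose Ci := color_class [set: gT] c i; pose Cj := color_class [set: gT] c j.
pose T (u v : bool) := match u, v with
  | false, true => Ci | true, false => Cj^-1 | _, _ => set0 end.
have CiE d : (d \in Ci) = (c d == i) by rewrite !inE.
have CjE d : (d \in Cj) = (c d == j) by rewrite !inE.
have disj d : c d == i -> c d != j by move/eqP=> ->.
exists T; split; last first.
  have [Ci0|Ci1] := eqVneq Ci set0.
    exists false => -[]// _; exists false; rewrite /= -card_gt0 card_invg card_gt0.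
    by apply: contraNneq cij => Cj0; rewrite -/Ci -/Cj Ci0 Cj0.
  by exists true => -[]// _; exists true.
split=> [[]//|[] [] d|s sP]; rewrite /= ?in_set0 //.
- by rewrite mem_invg CiE CjE => dj; apply: contraL dj => /disj.
- by rewrite mem_invg invgK CiE CjE => /disj.
have s2 p : (s p).2 = p.2.
  have degT u : \sum_v #|T u v| = if u then #|Cj| else #|Ci|.
    by rewrite big_bool /=; case: u; rewrite /= ?card_invg cards0 ?addn0.
  have := haar_aut_outdegree p sP; rewrite !degT.
  by case: (s p).2 p.2 => [] [] // e; rewrite e eqxx in cij.
have arcP := digraph_autP _ _ sP.
pose a g := (s (g, false)).1 * (s (1, false)).1^-1.
pose b g := (s (g, true)).1 * (s (1, false)).1^-1.
have sF g : s (g, false) = ((s (g, false)).1, false).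
  by rewrite {1}[s _]surjective_pairing s2.
have sT g : s (g, true) = ((s (g, true)).1, true).
  by rewrite {1}[s _]surjective_pairing s2.
have abP : color_auto [set: gT] c a b.
  split=> [g _|x y _ _ /mulIg e|x y _ _ /mulIg e|x y _ _].
  - by rewrite !inE.
  - have : s (x, false) = s (y, false) by rewrite sF e -sF.
    by move/perm_inj=> [].
  - have : s (x, true) = s (y, true) by rewrite sT e -sT.
    by move/perm_inj=> [].
  rewrite /a /b invMg invgK mulgA mulgKV.
  have := arcP (x, false) (y, true); rewrite sF sT /haar_arc /= !CiE => ei.
  have := arcP (y, true) (x, false); rewrite sF sT /haar_arc /= !mem_invg.
  rewrite !invMg !invgK !CjE => ej.
  (* Preserving classes [i] and [j] preserves the third, their complement. *)
  move: ei ej neij; case: (i) (j) => [[]|] [[]|] //;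
    by case: (c _) => [[]|]; case: (c _) => [[]|].
have a1 : a 1 = 1 by rewrite /a mulgV.
exists (s (1, false)).1 => -[h u] /=.
have [ah bh] := rigidc a b abP a1 h (in_setT h).
by case: u; [rewrite sT -{2}bh | rewrite sF -{2}ah]; rewrite mulgKV.
Qed.

(** A matching suffices: it identifies the parts, and an injection of at most two points fixing 1 is
    the identity. *)
Lemma small_rep : #|gT| <= 2 ->
  exists T : bool -> bool -> {set gT}, haar_rep T /\ sinks_in_one_part T.
Proof.
move=> gT2; pose c (g : gT) := if g == 1 then Some false else None.
have c1 : {in [set: gT], forall g, (c g == Some false) = (g == 1)}.
  by move=> g _; rewrite /c; case: (g == 1).
apply: (@rigid_rep c).
  move=> a b abP a1 g _; have ba := color_auto_matching (H := [set: gT]) c1 abP.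
  rewrite ba ?inE //; suff -> : a g = g by [].
  have [->//|g1] := eqVneq g 1.
  case: abP => _ a_inj _ _.
  have ag1 : a g != 1.
    by apply: contraNneq g1; rewrite -[X in _ = X]a1 => /a_inj->; rewrite ?inE.
  apply/eqP; apply: contraLR gT2 => ag; rewrite -ltnNge.
  have <- : #|[set 1; g; a g]| = 3.
    rewrite -setUA cardsU1 !inE cards2 ![1 == _]eq_sym negb_or g1 ag1.
    by rewrite [g == _]eq_sym ag.
  exact: max_card.
exists (Some false), (Some true); rewrite (color_class_matching (H := [set: gT]) c1).
rewrite cards1 (_ : color_class _ _ _ = set0) ?cards0 //.
by apply/setP=> g; rewrite !inE /c; case: (g == 1).
Qed.

(** Part [None] has out-degree 1 and the others 2, so it is preserved. The matchings labelled 1 then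
    identify the three parts, and the arcs labelled [x], [y], [z] force equivariance under
    generators. Antiparallel arcs are avoided because [x] and [y] are not 1. *)
Lemma tripartite_rep (x y z : gT) : x != 1 -> y != 1 ->
  <<[set x; y; z]>> = [set: gT] ->
  exists T : option bool -> option bool -> {set gT},
    haar_rep T /\ sinks_in_one_part T.
Proof.
move=> x1 y1 gen.
pose T (i j : option bool) : {set gT} := match i, j with
  | None, Some false => [set 1] | Some false, Some true => [set 1]
  | Some false, None => [set x] | Some true, Some false => [set y]
  | Some true, None => [set z] | _, _ => set0 end.
exists T; split; last first.
  exists None => -[[]|] // _; [exists None | exists None];
    by rewrite -card_gt0 cards1.
split=> [[[]|]//|[[]|] [[]|] d|s sP]; rewrite ?inE //.
- by move=> /eqP->; rewrite invg_eq1.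
- by move=> /eqP->; rewrite invg1 eq_sym.
- by move=> /eqP->; rewrite invg_eq1.
- by move=> /eqP->; rewrite invg1 eq_sym.
have arcP := digraph_autP _ _ sP.
have deg i : (\sum_j #|T i j| == 1%N) = (i == None).
  rewrite (bigD1 None) // (bigD1 (Some true)) // (bigD1 (Some false)) //= big1.
    by case: i => [[]|]; rewrite /= ?cards1 ?cards0.
  by case=> [[]|].
have s0 p : ((s p).2 == None) = (p.2 == None).
  by rewrite -!deg haar_aut_outdegree.
pose a g := (s (g, None)).1.
have sN g : s (g, None) = (a g, None).
  have := s0 (g, None); rewrite /a; case: (s _) => h i /= /eqP->.
  by [].
have sF g : s (g, Some false) = (a g, Some false).
  have := arcP (g, None) (g, Some false); rewrite sN /haar_arc /= mulgV set11.
  case: (s _) => h [[]|] /=; rewrite ?inE //.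
  by rewrite -eq_mulgV1 => /eqP->.
have sT g : s (g, Some true) = (a g, Some true).
  have := arcP (g, Some false) (g, Some true); have := s0 (g, Some true).
  rewrite sF /haar_arc /= mulgV set11.
  case: (s _) => h [[]|] //= _; rewrite inE // -eq_mulgV1.
  by move/eqP->.
exists (a 1).
suff aE g : a g = g * a 1 by case=> g [[]|]; rewrite ?sN ?sF ?sT /= aE.
pose a' g := a g * (a 1)^-1.
suff e : a' g = g by rewrite -{2}e mulgKV.
apply: (@left_equivariant_id _ [set: gT] [set x; y; z]) (in_setT g) => //.
- by move=> h _; rewrite inE.
- exact: subsetT.
- by rewrite gen.
- move=> d h Dd _; rewrite /a' mulgA; congr (_ * _).
  move: Dd; rewrite !inE => /orP[/orP[]|] /eqP->.
  + have := arcP (h, Some false) (x * h, None); rewrite sN sF /haar_arc /= mulgK.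
    by rewrite !inE eqxx => /eqP/(canRL (mulgKV _)).
  + have := arcP (h, Some true) (y * h, Some false); rewrite sT sF /haar_arc /= mulgK.
    by rewrite !inE eqxx => /eqP/(canRL (mulgKV _)).
  + have := arcP (h, Some true) (z * h, None); rewrite sN sT /haar_arc /= mulgK.
    by rewrite !inE eqxx => /eqP/(canRL (mulgKV _)).
- by rewrite /a' mulgV.
Qed.

Lemma add_sinks_POSR (I : finType) (T : I -> I -> {set gT}) m :
  haar_rep T -> sinks_in_one_part T -> #|I| <= m -> admits_POSR m [set: gT].
Proof.
move=> repT sinkT le; rewrite -(subnKC le); move: (m - _)%N => n {m le}.
elim: n I T repT sinkT => [|n IHn] I T repT sinkT.
  by rewrite addn0; have [i0 _] := sinkT; apply: haar_rep_POSR repT.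
have [T' [repT' sinkT']] := add_sink_rep repT sinkT.
by have := IHn _ _ repT' sinkT'; rewrite card_option addSnnS.
Qed.

End Representations.

(** * The exceptional groups *)

Section BipartiteObstructions.

Variables (gT : finGroupType) (T : bool -> bool -> {set gT}).
Hypothesis repT : haar_rep T.

Definition arc_color (d : gT) : option bool :=
  if d \in T false true then Some false
  else if d^-1 \in T true false then Some true else None.

Lemma arc_color_false d : (arc_color d == Some false) = (d \in T false true).
Proof. by rewrite /arc_color; do 2?case: ifP. Qed.

Lemma arc_color_true d : (arc_color d == Some true) = (d^-1 \in T true false).
Proof.
have [_ anti _] := repT.
by rewrite /arc_color; case: ifP => [/anti/negPf->|_]; last case: ifP.
Qed.

Lemma haar_arc_color g h u v : haar_arc T (g, u) (h, v) =
  match u, v with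
  | false, true => arc_color (h * g^-1) == Some false
  | true, false => arc_color (g * h^-1) == Some true
  | _, _ => false
  end.
Proof.
have [T0 _ _] := repT; rewrite /haar_arc /=.
case: u v => [] []; rewrite ?T0 ?inE ?arc_color_false ?arc_color_true //.
by rewrite invMg invgK.
Qed.

Lemma haar_rep_color_auto a b : color_auto [set: gT] arc_color a b ->
  exists k, forall g, a g = g * k /\ b g = g * k.
Proof.
case=> _ a_inj b_inj abc; have [_ _ autT] := repT.
pose s (p : gT * bool) := ((if p.2 then b else a) p.1, p.2).
have s_inj : injective s.
  case=> x u [y v] [+ uv]; rewrite /= uv.
  by case: v {uv} => [/b_inj|/a_inj] ->; rewrite ?inE.
have /autT[k kP] : perm s_inj \in digraph_aut (haar_arc T).
  apply/digraph_autP=> -[x u] [y v]; rewrite !permE !haar_arc_color /=.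
  by case: u v => [] []; rewrite // abc ?inE.
exists k => g; have := (kP (g, false), kP (g, true)); rewrite !permE /s /=.
by case=> -[-> [->]].
Qed.

(** Such a [k] would give an automorphism exchanging the two parts, which no translation does. *)
Lemma haar_rep_no_swap k : abelian [set: gT] ->
  ~ forall d, arc_color (k * d^-1) = omap negb (arc_color d).
Proof.
move=> abT ck; have [_ _ autT] := repT.
have gC (x y : gT) : x * y = y * x by apply: (centsP abT); rewrite inE.
pose s (p : gT * bool) := (if p.2 then p.1 else p.1 * k, ~~ p.2).
have s_inj : injective s.
  case=> x u [y v] [+ /(can_inj negbK) uv]; rewrite /= uv.
  by case: v {uv} => [->|/mulIg->].
have negc i c : (omap negb c == Some i) = (c == Some (~~ i)).
  by case: c i => [[]|] [].
have /autT[g /(_ (1, false))] : perm s_inj \in digraph_aut (haar_arc T).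
  apply/digraph_autP=> -[x u] [y v]; rewrite !permE !haar_arc_color /=.
  have E z t : z * k * t^-1 = k * (t * z^-1)^-1.
    by rewrite invMg invgK mulgA (gC z).
  by case: u v => [] []; rewrite //= E ck negc.
by rewrite permE.
Qed.

End BipartiteObstructions.

(** * Exhaustive checks over all colourings of a small group *)

Section ColoringTables.

Variables (gT : finGroupType) (els : seq gT).
Hypothesis elsP : forall g, g \in els.

Fixpoint all_colorings n : seq (seq (option bool)) :=
  if n is m.+1 then [seq i :: l | i <- all_colors, l <- all_colorings m]
  else [:: [::]].

Lemma all_coloringsP (c : gT -> option bool) (s : seq gT) :
  map c s \in all_colorings (size s).
Proof.
elim: s => // g s IHs.
rewrite -[all_colorings _]/[seq i :: l | i <- all_colors, l <- all_colorings (size s)].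
 apply/allpairsP; exists (c g, map c s).
by rewrite mem_all_colors.
Qed.

Lemma nth_coloring (c : gT -> option bool) g :
  nth None (map c els) (index g els) = c g.
Proof. by rewrite (nth_map g) ?index_mem ?nth_index. Qed.

Definition reflection_or_swap (l : seq (option bool)) :=
  let c g := nth None l (index g els) in
  has (fun k => all (fun d => c (k * d^-1) == c d) els
             || all (fun d => c (k * d^-1) == omap negb (c d)) els) els.

(** A symmetry [d |-> k * d^-1] of the colouring is induced by inversion on one part and the
    reflection on the other. Inversion fixes 1, so as a translation it would be trivial. *)
Lemma no_rep_reflection : abelian [set: gT] -> ~~ [forall x : gT, x^-1 == x] ->
  all reflection_or_swap (all_colorings (size els)) ->
  forall T : bool -> bool -> {set gT}, ~ haar_rep T.
Proof.
move=> abT /forallPn[x xVx] /allP tableP T repT.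
have gC (y z : gT) : y * z = z * y by apply: (centsP abT); rewrite inE.
have /tableP/hasP[k _] := all_coloringsP (arc_color T) els.
case/orP=> /allP ck; last first.
  apply: (haar_rep_no_swap repT (k := k) abT) => d.
  by have /eqP := ck d (elsP d); rewrite !nth_coloring.
have [|z zP] := haar_rep_color_auto repT (a := invg) (b := fun h => k * h^-1).
  split=> [g _|y t _ _ /invg_inj|y t _ _ /mulgI/invg_inj|y t _ _] //.
  have /eqP := ck (t * y^-1) (elsP _); rewrite !nth_coloring => <-.
  by rewrite invMg !invgK (gC y) mulgA.
have [z1 _] := zP 1; have [] := zP x.
by rewrite -(mul1g z) -z1 invg1 mulg1 => /eqP; rewrite (negPf xVx).
Qed.

Variable f : gT -> gT -> bool.

(** In an entry [(w, v, e)], [f w] is a nonzero functional vanishing on the direction [v], and [e]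
    selects a coset of its kernel, [true] being the kernel itself. *)
Definition transvections : seq (gT * gT * bool) :=
  [seq p <- [seq (q, e) | q <- [seq (w, v) | w <- els, v <- els],
                          e <- [:: false; true]]
     | [&& p.1.2 != 1, ~~ f p.1.1 p.1.2 & has (f p.1.1) els]].

(** Positions in [els] are precomputed, so that testing a colouring only compares list entries. *)
Definition moved_pairs (p : gT * gT * bool) : seq (nat * nat) :=
  [seq (index d els, index (d * p.1.2) els) | d <- els & f p.1.1 d (+) p.2].

Definition transvection_table :=
  let P := map moved_pairs transvections in
  all (fun l => has (all (fun ij => nth None l ij.1 == nth None l ij.2)) P)
      (all_colorings (size els)).

(* Some translation [d |-> d * v] restricted to one coset of an index-2
   subgroup containing [v] preserves the colouring; it is induced by a
   transvection on one part and an affine transvection on the other. *)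
Lemma no_rep_transvection : (forall x : gT, x * x = 1) ->
  (forall w x y, f w (x * y) = f w x (+) f w y) -> transvection_table ->
  forall T : bool -> bool -> {set gT}, ~ haar_rep T.
Proof.
move=> sq1 fM /allP tableP T repT.
have xV (x : gT) : x^-1 = x by apply: (mulgI x); rewrite mulgV sq1.
have gC (y z : gT) : y * z = z * y by rewrite -[y * z]xV invMg !xV.
have /tableP/hasP[_ /mapP[[[w v] e] + ->]] := all_coloringsP (arc_color T) els.
rewrite mem_filter /= => /andP[/and3P[v1 fv0 /hasP[x _ fx]] _] /allP ck.
have fv (t : bool) : f w (if t then v else 1) = false.
  by case: t; rewrite ?(negPf fv0) // -(sq1 1) fM addbb.
pose M t g := g * (if f w g (+) t then v else 1).
have MK t : cancel (M t) (M t).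
  move=> g; rewrite /M fM fv addbF -mulgA.
  by case: ifP; rewrite ?sq1 ?mulg1.
(* The twists by [v] on the two parts combine into one on the quotient, because [f w] is additive
   and [v * v = 1]. *)
have MM g h : M e h * (M false g)^-1 = M e (h * g^-1).
  rewrite /M !xV fM addbF.
  by case: (f w h) (f w g) e {ck MK} => [] [] [];
    rewrite /= ?mulg1 ?mulgA // -?mulgA ?[v * (g * v)]mulgA ?[v * g]gC
            -?mulgA ?sq1 ?mulg1.
have [|k kP] := haar_rep_color_auto repT (a := M false) (b := M e).
  split=> [g _|y t _ _|y t _ _|y t _ _].
  - by rewrite !inE.
  - exact: (can_inj (MK false)).
  - exact: (can_inj (MK e)).
  rewrite MM /M; case: ifP => [fe|]; last by rewrite mulg1.
  set d := t * y^-1 in fe *.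
  have := ck (index d els, index (d * v) els); rewrite /= !nth_coloring.
  move=> H; apply/esym/eqP/H/mapP; exists d => //.
  by rewrite mem_filter fe elsP.
(* Fixing 1, the translation would be trivial, yet [M false] moves [x]. *)
have M1 : M false 1 = 1 by rewrite /M (fv false) mulg1.
have [k1 _] := kP 1; rewrite M1 mul1g in k1.
have [/eqP + _] := kP x; rewrite -k1 mulg1 /M fx /=.
by rewrite -{2}[x]mulg1 (inj_eq (mulgI x)) (negPf v1).
Qed.

End ColoringTables.

Lemma odd_Z2M (x y : 'Z_2) : odd (x * y : 'Z_2)%g = odd x (+) odd y.
Proof. by move: (Zp2P x) (Zp2P y) => [->|->] [->|->]. Qed.

Lemma Z3_no_rep (T : bool -> bool -> {set 'Z_3}) : ~ haar_rep T.
Proof.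
apply: (@no_rep_reflection 'Z_3 [:: 0; 1; 2%:R]%R _ _ _ _ T).
- by move=> i; case: (Zp3P i) => ->.
- by apply/centsP=> x _ y _; apply: Zp_mulgC.
- by apply/forallPn; exists 1%R.
- by vm_compute.
Qed.

Definition dot2 (w x : 'Z_2 * 'Z_2) : bool :=
  (odd w.1 && odd x.1) (+) (odd w.2 && odd x.2).

Definition dot3 (w x : 'Z_2 * 'Z_2 * 'Z_2) : bool :=
  dot2 w.1 x.1 (+) (odd w.2 && odd x.2).

Lemma dot2M w x y : dot2 w (x * y) = dot2 w x (+) dot2 w y.
Proof. by rewrite /dot2 !odd_Z2M !andb_addr addbACA. Qed.

Lemma dot3M w x y : dot3 w (x * y) = dot3 w x (+) dot3 w y.
Proof. by rewrite /dot3 dot2M odd_Z2M andb_addr addbACA. Qed.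

Lemma Z22_no_rep (T : bool -> bool -> {set 'Z_2 * 'Z_2}) : ~ haar_rep T.
Proof.
pose e2 : seq 'Z_2 := [:: 0; 1]%R.
pose els : seq ('Z_2 * 'Z_2) := [seq (i, j) | i <- e2, j <- e2].
apply: (@no_rep_transvection _ els _ dot2 _ dot2M _ T).
- by case=> i j; move: (Zp2P i) (Zp2P j); do 2![case=> ->]; vm_compute.
- by case=> i j; move: (Zp2P i) (Zp2P j); do 2![case=> ->]; apply/eqP; vm_compute.
- by vm_compute.
Qed.

Lemma Z222_no_rep (T : bool -> bool -> {set 'Z_2 * 'Z_2 * 'Z_2}) : ~ haar_rep T.
Proof.
pose e2 : seq 'Z_2 := [:: 0; 1]%R.
pose els : seq ('Z_2 * 'Z_2 * 'Z_2) :=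
  [seq (p, k) | p <- [seq (i, j) | i <- e2, j <- e2], k <- e2].
apply: (@no_rep_transvection _ els _ dot3 _ dot3M _ T).
- case=> [[i j] k]; move: (Zp2P i) (Zp2P j) (Zp2P k).
  by do 3![case=> ->]; vm_compute.
- case=> [[i j] k]; move: (Zp2P i) (Zp2P j) (Zp2P k).
  by do 3![case=> ->]; apply/eqP; vm_compute.
- by vm_compute.
Qed.

(** * Classification *)

Lemma abelem_prod (rT sT : finGroupType) p : prime p ->
  p.-abelem [set: rT] -> p.-abelem [set: sT] -> p.-abelem [set: rT * sT].
Proof.
move=> p_pr /(abelemP p_pr)[abR expR] /(abelemP p_pr)[abS expS].
apply/(abelemP p_pr); split.
  apply/centsP=> -[x1 x2] _ [y1 y2] _; congr pair.
    by apply: (centsP abR); rewrite inE.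
  by apply: (centsP abS); rewrite inE.
have pairX n x y : (x, y) ^+ n = (x ^+ n, y ^+ n) :> rT * sT.
  by elim: n => // n IHn; rewrite !expgS IHn.
by case=> x y _; rewrite pairX expR ?inE // expS ?inE.
Qed.

Lemma abelem_Zp p : prime p -> p.-abelem [set: 'Z_p].
Proof.
move=> p_pr; apply/(abelemP p_pr); split.
  by apply/centsP=> x _ y _; apply: Zp_mulgC.
have cardZ : #|[set: 'Z_p]| = p by rewrite cardsT card_ord Zp_cast ?prime_gt1.
by move=> x _; have := expg_cardG (in_setT x); rewrite cardZ.
Qed.

Section Classification.

Variable gT : finGroupType.

Lemma exponent_prime_pgroup p : prime p ->
  (forall x : gT, x ^+ p = 1) -> p.-group [set: gT].
Proof.
move=> p_pr xp; rewrite -pnat_exponent; apply: (@pnat_dvd _ p).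
  by apply/exponentP=> x _.
exact: pnat_id.
Qed.

(** A group of exponent [p] and large enough order has a subgroup of order [p ^ n]; being abelian,
    it is elementary and isomorphic to the base [rT]. *)
Lemma extendable_elementary (rT : finGroupType) p n :
  prime p -> p.-abelem [set: rT] -> #|rT| = (p ^ n)%N ->
  extendable [set: rT] -> (forall x : gT, x ^+ p = 1) ->
  n <= logn p #|gT| ->
  (forall H : {group gT}, #|H| = (p ^ n)%N -> abelian H) ->
  extendable [set: gT].
Proof.
move=> p_pr abR cardR extR xp len abn.
have pG := exponent_prime_pgroup p_pr xp; rewrite -cardsT in len.
have [H [_ _ cardH]] := normal_pgroup pG (normal_refl _) len.
apply: (@extendable_setT _ H); apply: isog_extendable extR.
rewrite (isog_abelem_card _ abR) cardsT cardR cardH eqxx andbT.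
by apply/(abelemP p_pr); split=> [|x _]; rewrite ?abn.
Qed.

Definition exceptional (G : {set gT}) :=
  [\/ G \isog [set: 'Z_3], G \isog [set: 'Z_2 * 'Z_2]
    | G \isog [set: 'Z_2 * 'Z_2 * 'Z_2]].

Lemma exponent2_classification : (forall x : gT, x ^+ 2 = 1) ->
  [\/ extendable [set: gT], #|gT| <= 2 | exceptional [set: gT]].
Proof.
move=> x2; have pG := exponent_prime_pgroup (erefl : prime 2) x2.
have ab2 : 2.-abelem [set: 'Z_2] by apply: abelem_Zp.
have ab22 := abelem_prod (erefl : prime 2) ab2 ab2.
have ab222 := abelem_prod (erefl : prime 2) ab22 ab2.
have xV (x : gT) : x^-1 = x by apply: (mulgI x); rewrite mulgV -(x2 x).
have abT : abelian [set: gT].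
  by apply/centsP=> x _ y _; rewrite /commute -[x * y]xV invMg !xV.
have abG : 2.-abelem [set: gT] by apply/abelemP=> //; split.
have := card_pgroup pG; rewrite cardsT.
case E: (logn 2 #|gT|) => [|[|[|[|n]]]] cardG.
- by constructor 2; rewrite cardG.
- by constructor 2; rewrite cardG.
- by constructor 3; constructor 2;
    rewrite (isog_abelem_card _ abG) ab22 !cardsT card_prod !card_ord cardG.
- by constructor 3; constructor 3;
    rewrite (isog_abelem_card _ abG) ab222 !cardsT !card_prod !card_ord cardG.
constructor 1; apply: (@extendable_elementary _ 2 4 _ _ _ extendable_Z2222 x2) => //.
- exact: (abelem_prod _ ab222 ab2).
- by rewrite !card_prod !card_ord.
- by rewrite E.
- by move=> H _; apply: abelianS abT; apply: subsetT.
Qed.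

Lemma exponent3_classification : (forall x : gT, x ^+ 3 = 1) ->
  [\/ extendable [set: gT], #|gT| <= 2 | exceptional [set: gT]].
Proof.
move=> x3; have pG := exponent_prime_pgroup (erefl : prime 3) x3.
have ab3 : 3.-abelem [set: 'Z_3] by apply: abelem_Zp.
have := card_pgroup pG; rewrite cardsT.
case E: (logn 3 #|gT|) => [|[|n]] cardG.
- by constructor 2; rewrite cardG.
- constructor 3; constructor 1.
  rewrite isog_sym (isog_abelem_card _ ab3) !cardsT card_ord cardG eqxx andbT.
  apply/abelemP=> //; split=> //; apply: cyclic_abelian.
  by apply: prime_cyclic; rewrite cardsT cardG.
constructor 1; apply: (@extendable_elementary _ 3 2 _ _ _ extendable_Z33 x3) => //.
- exact: (abelem_prod _ ab3 ab3).
- by rewrite !card_prod !card_ord.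
- by rewrite E.
- by move=> H; apply: card_p2group_abelian.
Qed.

(** Without elements of order above 3, either orders 2 and 3 both occur or the exponent divides 2 or
    3. *)
Lemma extendable_classification :
  [\/ extendable [set: gT], #|gT| <= 2 | exceptional [set: gT]].
Proof.
have [y y_gt3|le3] := pickP (fun y : gT => 3 < #[y]).
  by constructor 1; apply: extendable_setT (extendable_cycle y_gt3).
have o123 (y : gT) : [\/ #[y] = 1%N, #[y] = 2 | #[y] = 3].
  have := le3 y; have := order_gt0 y.
  by case: #[y] => [|[|[|[|n]]]] // _ _; [constructor 1|constructor 2|constructor 3].
have [x /eqP ox|no3] := pickP (fun x : gT => #[x] == 3); last first.
  apply: exponent2_classification => x; apply/eqP; rewrite -order_dvdn.
  by have := no3 x; case: (o123 x) => ->.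
have [y /eqP oy|no2] := pickP (fun y : gT => #[y] == 2); last first.
  apply: exponent3_classification => y; apply/eqP; rewrite -order_dvdn.
  by have := no2 y; case: (o123 y) => ->.
by constructor 1; apply: extendable_setT (extendable_order23 ox oy).
Qed.

Lemma bipartite_rep : ~ exceptional [set: gT] ->
  exists T : bool -> bool -> {set gT}, haar_rep T /\ sinks_in_one_part T.
Proof.
case: extendable_classification => // [[_ [c [rigidc _ _ cij]]]|gT2] _.
  exact: rigid_rep rigidc cij.
exact: small_rep.
Qed.

Definition three_generated (rT : finGroupType) :=
  exists x y z : rT, [/\ x != 1, y != 1 & <<[set x; y; z]>> = [set: rT]].

Lemma three_generated_subproducts (rT : finGroupType) (x y z : rT) :
  x != 1 -> y != 1 -> (forall g, g \in subproducts [:: x; x; y; z]) ->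
  three_generated rT.
Proof.
move=> x1 y1 gen; exists x, y, z; split=> //.
apply/setP=> g; rewrite inE; apply: subproducts_gen (gen g) => d.
by rewrite !inE orbA orbb orbA.
Qed.

Lemma isog_three_generated (rT : finGroupType) :
  [set: gT] \isog [set: rT] -> three_generated rT -> three_generated gT.
Proof.
rewrite isog_sym => /isogP[f injf imf] [x [y [z [x1 y1 gen]]]].
exists (f x), (f y), (f z); split; rewrite ?morph_injm_eq1 ?inE //.
transitivity (f @* <<[set x; y; z]>>); last by rewrite gen imf.
by rewrite morphim_gen ?subsetT // !morphimU !morphim_set1 ?inE.
Qed.

Lemma exceptional_three_generated : exceptional [set: gT] -> three_generated gT.
Proof.
case=> /isog_three_generated; apply.
- apply: (@three_generated_subproducts 'Z_3 1%R 1%R 1%R) => // i.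
  by move: (Zp3P i); case=> ->; vm_compute.
- apply: (@three_generated_subproducts ('Z_2 * 'Z_2)%type
            (1, 0)%R (0, 1)%R (0, 1)%R) => //.
  by case=> i j; move: (Zp2P i) (Zp2P j); do 2![case=> ->]; vm_compute.
- apply: (@three_generated_subproducts ('Z_2 * 'Z_2 * 'Z_2)%type
            (1, 0, 0)%R (0, 1, 0)%R (0, 0, 1)%R) => //.
  case=> [[i j] k]; move: (Zp2P i) (Zp2P j) (Zp2P k).
  by do 3![case=> ->]; vm_compute.
Qed.

Lemma exceptional_no_POSR : exceptional [set: gT] -> ~ admits_POSR 2 [set: gT].
Proof.
have move_POSR (rT : finGroupType) : [set: gT] \isog [set: rT] ->
    admits_POSR 2 [set: gT] -> exists T : bool -> bool -> {set rT}, haar_rep T.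
  move=> iso [V [arc [P [h1 h2 h3 h4 h5]]]]; apply: POSR_haar_rep.
  rewrite card_bool; exists V, arc, P; split=> //; exact: isog_trans h3 iso.
by case=> /move_POSR h /h[T]; [apply: Z3_no_rep | apply: Z22_no_rep | apply: Z222_no_rep].
Qed.

Lemma POSR_iff m : 2 <= m ->
  admits_POSR m [set: gT] <-> ~ (m = 2 /\ exceptional [set: gT]).
Proof.
move=> m2; split=> [POSRm [em exc]|nexc].
  by rewrite em in POSRm; apply: exceptional_no_POSR exc POSRm.
(* Isomorphism is a boolean here, so this case split is constructive. *)
have [exc|nex] : exceptional [set: gT] \/ ~ exceptional [set: gT].
  rewrite /exceptional; do 3![case: (boolP (_ \isog _)) => ?];
    by [left; constructor 1 | left; constructor 2 | left; constructor 3
       | right; case; apply/negP].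
- have m3 : 2 < m by rewrite ltn_neqAle m2 andbT eq_sym; apply/eqP=> em; apply: nexc.
  have [x [y [z [x1 y1 gen]]]] := exceptional_three_generated exc.
  have [T [repT sinkT]] := tripartite_rep x1 y1 gen.
  by apply: add_sinks_POSR repT sinkT _; rewrite card_option card_bool.
- have [T [repT sinkT]] := bipartite_rep nex.
  by apply: add_sinks_POSR repT sinkT _; rewrite card_bool.
Qed.

End Classification.

Theorem theorem1p3 (m : nat) (gT : finGroupType) (G : {group gT})
    (hm : 2 <= m) :
  admits_POSR m G <->
  ~ (m = 2 /\
     [\/ G \isog [set: 'Z_3],
         G \isog [set: 'Z_2 * 'Z_2]
       | G \isog [set: 'Z_2 * 'Z_2 * 'Z_2]]).
Proof.
(* Passing to the type [[subg G]] turns [G] into a full group. *)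
have iso := isog_subg G.
have isoE (rT : finGroupType) : (G \isog [set: rT]) = ([set: [subg G]] \isog [set: rT]).
  by apply/idP/idP; apply: isog_trans; rewrite // isog_sym.
have POSRE : admits_POSR m G <-> admits_POSR m [set: [subg G]].
  split=> -[V [arc [P [h1 h2 h3 h4 h5]]]]; exists V, arc, P; split=> //.
    exact: isog_trans h3 iso.
  by apply: isog_trans h3 _; rewrite isog_sym.
by rewrite !isoE; apply: (iff_trans POSRE); apply: POSR_iff.
Qed.
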